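(* Let $\mathbb{H}_1,\mathbb{H}_2$ be arbitrary hyperfields and let $f\colon \mathbb{H}_1\to\mathbb{H}_2$ be a relatively algebraically closed homomorphism. Then for every polynomial $p\in\mathbb{H}_1[X_1,\dots,X_n]$, $$V(f_*(p)) = f(V(p)) := \{(f(a_1),\dots,f(a_n))\in\mathbb{H}_2^n \mid \mathbf{a}=(a_1,\dots,a_n)\in V(p)\}.$$
   Context: **Hyperfields.** A hyperoperation on a set $H$ is a map $\boxplus$ from $H\times H$ to the non-empty subsets of $H$; for subsets, $A\boxplus B=\bigcup_{a\in A,b\in B}a\boxplus b$, singletons are identified with their elements, and longer hypersums are obtained by iteration. A hyperfield is a tuple $(\mathbb{H},\boxplus,\odot,0_{\mathbb H},1_{\mathbb H})$ such that: $\boxplus$ is an associative and commutative hyperoperation; $0_{\mathbb H}\boxplus a=a$; each $a$ has a unique $-a$ with $0_{\mathbb H}\in a\boxplus(-a)$; $a\in b\boxplus c$ iff $c\in a\boxplus(-b)$; $\mathbb{H}^\times:=\mathbb{H}\setminus\{0_{\mathbb H}\}$ is an abelian group under the single-valued operation $\odot$ with identity $1_{\mathbb H}$; $a\odot(b\boxplus c)=(a\odot b)\boxplus(a\odot c)$; and $0_{\mathbb H}\odot a=0_{\mathbb H}$. **Homomorphisms.** A hyperfield homomorphism $f\colon\mathbb{H}_1\to\mathbb{H}_2$ is a map with $f(a\boxplus_1 b)\subseteq f(a)\boxplus_2 f(b)$, $f(a\odot_1 b)=f(a)\odot_2 f(b)$, $f(0)=0$, $f(1)=1$. It is applied coordinatewise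 to tuples. **Polynomials.** $\mathbb{H}[X_1,\dots,X_n]$ is the set of formal expressions $p=\boxplus_{\mathbf{d}\in D}c_{\mathbf d}\odot \mathbf{X}^{\mathbf d}$ with $D\subset\mathbb{Z}_{\ge0}^n$ finite and $c_{\mathbf d}\in\mathbb{H}^\times$. Evaluation at $\mathbf a\in\mathbb{H}^n$ gives a subset $p(\mathbf a)=\boxplus_{\mathbf d\in D}c_{\mathbf d}\odot\mathbf a^{\mathbf d}\subseteq\mathbb{H}$, and $V(p)=\{\mathbf a\in\mathbb{H}^n\mid 0_{\mathbb H}\in p(\mathbf a)\}$. The push-forward of $p$ along $f$ is $f_*(p)=\boxplus_{\mathbf d\in D}f(c_{\mathbf d})\odot\mathbf X^{\mathbf d}$. **RAC.** A surjective hyperfield homomorphism $f\colon\mathbb{H}_1\to\mathbb{H}_2$ is relatively algebraically closed (RAC) if for every univariate polynomial $p\in\mathbb{H}_1[X]$ and every root $\beta\in V(f_*(p))$ there exists $\alpha\in f^{-1}(\beta)$ with $\alpha\in V(p)$. *)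

(* Defs.v *)
From HB Require Import structures.
From mathcomp Require Import all_boot finmap.
From mathcomp Require Import boolp classical_sets.
Set Implicit Arguments.
Unset Strict Implicit.
Unset Printing Implicit Defensive.

Local Open Scope classical_set_scope.

Definition setwise (H : Type) (op : H -> H -> set H) (A B : set H) : set H :=
  \bigcup_(a in A) \bigcup_(b in B) op a b.

(* The group axioms are only imposed on the nonzero elements; [hmul] is shown
   below to be a commutative monoid law on the whole carrier.  [hopp] is not
   extra data, since [hadd_opp] and [hopp_uniq] determine it. *)
HB.mixin Record isHyperfield (H : Type) := {
  hadd : H -> H -> set H;
  hmul : H -> H -> H;
  hopp : H -> H;
  h0 : H;
  h1 : H;
  hadd_nonempty : forall a b, hadd a b !=set0;
  hadd_assoc : forall a b c,
    setwise hadd (hadd a b) [set c] = setwise hadd [set a] (hadd b c);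
  hadd_comm : forall a b, hadd a b = hadd b a;
  hadd_0l : forall a, hadd h0 a = [set a];
  hadd_opp : forall a, hadd a (hopp a) h0;
  hopp_uniq : forall a b, hadd a b h0 -> b = hopp a;
  hadd_rev : forall a b c, hadd b c a <-> hadd a (hopp b) c;
  h1_neq0 : h1 <> h0;
  hmul_neq0 : forall a b, a <> h0 -> b <> h0 -> hmul a b <> h0;
  hmul_assoc : forall a b c, a <> h0 -> b <> h0 -> c <> h0 ->
    hmul a (hmul b c) = hmul (hmul a b) c;
  hmul_comm : forall a b, a <> h0 -> b <> h0 -> hmul a b = hmul b a;
  hmul_1l : forall a, a <> h0 -> hmul h1 a = a;
  hmul_inv : forall a, a <> h0 -> exists2 b, b <> h0 & hmul b a = h1;
  hmul_distr : forall a b c,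
    [set hmul a x | x in hadd b c] = hadd (hmul a b) (hmul a c);
  hmul_0l : forall a, hmul h0 a = h0
}.

#[short(type="hyperfieldType")]
HB.structure Definition Hyperfield := {H of isHyperfield H}.

HB.mixin Record isHyperfieldHom (H1 H2 : hyperfieldType) (f : H1 -> H2) := {
  hom_add : forall a b, f @` hadd a b `<=` hadd (f a) (f b);
  hom_mul : forall a b, f (hmul a b) = hmul (f a) (f b);
  hom_0 : f h0 = h0;
  hom_1 : f h1 = h1
}.

#[short(type="hyperfieldHom")]
HB.structure Definition HyperfieldHom (H1 H2 : hyperfieldType) :=
  {f of isHyperfieldHom H1 H2 f}.

Section HyperfieldTheory.
Variable H : hyperfieldType.
Implicit Types (a b c : H) (A B C : set H).

Lemma hadd_0r a : hadd a h0 = [set a].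
Proof. by rewrite hadd_comm hadd_0l. Qed.

Lemma hmul_0r a : hmul a h0 = h0.
Proof.
have [->|a0] := pselect (a = h0); first exact: hmul_0l.
apply: contrapT => x0; set x := hmul a h0 in x0.
have ox0 : hopp x <> h0.
  move=> e; apply: x0; have := hadd_opp x.
  by rewrite e hadd_0r => ->.
have [b b0 ba] := hmul_inv a a0.
have abK : hmul a (hmul b (hopp x)) = hopp x.
  by rewrite hmul_assoc// (hmul_comm a b a0 b0) ba hmul_1l.
have := hmul_distr a h0 (hmul b (hopp x)).
rewrite hadd_0l image_set1 abK => e.
by have := hadd_opp x; rewrite -e => /esym.
Qed.

Lemma hmulC : commutative (@hmul H).
Proof.
move=> a b; have [->|a0] := pselect (a = h0); first by rewrite hmul_0l hmul_0r.
have [->|b0] := pselect (b = h0); first by rewrite hmul_0l hmul_0r.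
exact: hmul_comm.
Qed.

Lemma hmulA : associative (@hmul H).
Proof.
move=> a b c; have [->|a0] := pselect (a = h0); first by rewrite !hmul_0l.
have [->|b0] := pselect (b = h0); first by rewrite hmul_0r !hmul_0l hmul_0r.
have [->|c0] := pselect (c = h0); first by rewrite !hmul_0r.
exact: hmul_assoc.
Qed.

Lemma hmul1l : left_id h1 (@hmul H).
Proof.
by move=> a; have [->|/hmul_1l//] := pselect (a = h0); rewrite hmul_0r.
Qed.

Definition hsetadd A B : set H := setwise hadd A B.

Lemma hsetaddC : commutative hsetadd.
Proof.
by move=> A B; apply/seteqP; split=> x [a Aa [b Bb abx]];
  exists b => //; exists a => //; rewrite hadd_comm.
Qed.

Lemma hsetadd0l : left_id [set h0] hsetadd.
Proof.
move=> A; apply/seteqP; split=> x.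
  by move=> [_ -> [b Ab]]; rewrite hadd_0l => ->.
by move=> Ax; exists h0 => //; exists x => //; rewrite hadd_0l.
Qed.

Lemma hsetaddA : associative hsetadd.
Proof.
move=> A B C; apply/seteqP; split=> x.
  move=> [a Aa [y [b Bb [c Cc bcy]] ayx]].
  have : setwise hadd [set a] (hadd b c) x by exists a => //; exists y.
  rewrite -hadd_assoc => -[z abz [_ -> zcx]].
  by exists z; [exists a => //; exists b | exists c].
move=> [y [a Aa [b Bb aby]] [c Cc ycx]].
have : setwise hadd (hadd a b) [set c] x by exists y => //; exists c.
rewrite hadd_assoc => -[_ -> [z bcz azx]].
by exists a => //; exists z => //; exists b => //; exists c.
Qed.

End HyperfieldTheory.

HB.instance Definition _ (H : hyperfieldType) :=
  Monoid.isComLaw.Build H h1 (@hmul H) (@hmulA H) (@hmulC H) (@hmul1l H).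

HB.instance Definition _ (H : hyperfieldType) :=
  Monoid.isComLaw.Build (set H) [set h0] (@hsetadd H)
    (@hsetaddA H) (@hsetaddC H) (@hsetadd0l H).

Lemma hom_neq0 (H1 H2 : hyperfieldType) (f : hyperfieldHom H1 H2) (a : H1) :
  a <> h0 -> f a <> h0.
Proof.
move=> a0 fa0; have [b _ ba1] := hmul_inv a a0; apply: (@h1_neq0 H2).
by rewrite -(hom_1 (s := f)) -ba1 hom_mul fa0 hmul_0r.
Qed.

(* [expts p] is the finite set D of exponents; it may be empty. *)
Record hpoly (H : hyperfieldType) (n : nat) := HPoly {
  expts : {fset n.-tuple nat};
  coef : expts -> H;
  coef_neq0 : forall d, coef d <> h0
}.

Definition hexp (H : hyperfieldType) (a : H) (k : nat) : H :=
  iter k (hmul a) h1.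

Definition monomial (H : hyperfieldType) (n : nat) (a : n.-tuple H)
    (d : n.-tuple nat) : H :=
  \big[hmul/h1]_(i < n) hexp (tnth a i) (tnth d i).

(* The empty hypersum is [set h0]. *)
Definition heval (H : hyperfieldType) (n : nat) (p : hpoly H n)
    (a : n.-tuple H) : set H :=
  \big[@hsetadd H/[set h0]]_(d : expts p)
    [set hmul (coef d) (monomial a (val d))].

Definition zeros (H : hyperfieldType) (n : nat) (p : hpoly H n) :
    set (n.-tuple H) :=
  [set a | heval p a h0].

Definition pushforward (H1 H2 : hyperfieldType) (f : hyperfieldHom H1 H2)
    (n : nat) (p : hpoly H1 n) : hpoly H2 n :=
  HPoly (fun d => hom_neq0 (f := f) (@coef_neq0 H1 n p d)).

Definition relatively_algebraically_closed (H1 H2 : hyperfieldType)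
    (f : hyperfieldHom H1 H2) : Prop :=
  (forall b : H2, exists a : H1, f a = b) /\
  forall (p : hpoly H1 1) (beta : H2),
    zeros (pushforward f p) [tuple beta] ->
    exists2 alpha : H1, f alpha = beta & zeros p [tuple alpha].

(* Main.v *)
(** Lift the root [beta] to an arbitrary tuple [a] and substitute
    [X_i := a_i X^(M^i)] in [p], where [M] exceeds every exponent of [p]. By
    uniqueness of base-[M] expansions, distinct monomials of [p] go to distinct
    powers of [X], so the result is a genuine univariate polynomial, with
    coefficients [c_d a^d], and [1] is a root of its push-forward. A root
    [alpha] over [1] yields the zero [(a_i alpha^(M^i))_i] of [p] over [beta]. *)
Require Import Defs.
From mathcomp Require Import all_boot finmap.
From mathcomp Require Import boolp classical_sets.

Local Open Scope classical_set_scope.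

Section Hexp.
Variable H : hyperfieldType.
Implicit Types a b : H.

Lemma hexpS a k : hexp a k.+1 = hmul a (hexp a k).
Proof. by []. Qed.

Lemma hexp1n k : hexp (@h1 H) k = h1.
Proof. by elim: k => // k IH; rewrite hexpS IH hmul1l. Qed.

Lemma hexpD a j k : hexp a (j + k) = hmul (hexp a j) (hexp a k).
Proof.
by elim: j => [|j IH]; rewrite ?hmul1l// addSn !hexpS IH hmulA.
Qed.

Lemma hexpMl a b k : hexp (hmul a b) k = hmul (hexp a k) (hexp b k).
Proof.
elim: k => [|k IH]; first by rewrite hmul1l.
by rewrite !hexpS IH -!hmulA; congr hmul; rewrite !hmulA (hmulC b).
Qed.

Lemma hexpM a j k : hexp a (j * k) = hexp (hexp a j) k.
Proof.
by elim: k => [|k IH]; rewrite ?muln0// mulnS hexpD IH hexpS.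
Qed.

(** Used with [N i] a power of the base, so that the exponent of [x] encodes the whole tuple [d]. *)
Lemma monomial_subst n (a : n.-tuple H) (N : 'I_n -> nat) (x : H)
    (d : n.-tuple nat) :
  monomial [tuple hmul (tnth a i) (hexp x (N i)) | i < n] d =
  hmul (monomial a d) (hexp x (\sum_(i < n) tnth d i * N i)).
Proof.
rewrite (big_morph (hexp x) (hexpD x) (erefl : hexp x 0 = h1)) -big_split /=.
by apply: eq_bigr => i _; rewrite tnth_mktuple hexpMl mulnC hexpM.
Qed.

Lemma heval1 (q : hpoly H 1) (x : H) :
  heval q [tuple x] = \big[@hsetadd H/[set h0]]_(d : expts q)
    [set hmul (coef d) (hexp x (tnth (val d) ord0))].
Proof. by apply: eq_bigr => d _; rewrite /monomial big_ord1. Qed.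

End Hexp.

Section Hom.
Variables (H1 H2 : hyperfieldType) (f : hyperfieldHom H1 H2).

Lemma hom_hexp a k : f (hexp a k) = hexp (f a) k.
Proof. by elim: k => [|k IH]; rewrite ?hom_1// !hexpS hom_mul IH. Qed.

Lemma hom_monomial n (a : n.-tuple H1) d :
  f (monomial a d) = monomial (map_tuple f a) d.
Proof.
rewrite /monomial (big_morph f (hom_mul (s := f)) (hom_1 (s := f))).
by apply: eq_bigr => i _; rewrite hom_hexp tnth_map.
Qed.

(** Each hyperaddition preserves the inclusion, because [f] is a homomorphism. Applied to [h0], this
    is the easy half of the theorem. *)
Lemma hom_heval n (p : hpoly H1 n) (a : n.-tuple H1) :
  f @` heval p a `<=` heval (pushforward f p) (map_tuple f a).
Proof.
apply: (big_ind2 (fun A B => f @` A `<=` B)).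
- by rewrite image_set1 hom_0.
- move=> A A' B B' AA' BB' _ [x [u Au [v Bv uvx]] <-].
  exists (f u); first by apply: AA'; exists u.
  exists (f v); first by apply: BB'; exists v.
  by apply: (hom_add (s := f)); exists x.
- by move=> d _; rewrite image_set1 hom_mul hom_monomial.
Qed.

End Hom.

(* The arbitrary summand [G] covers at once the evaluations of the polynomial
   and of its push-forwards. *)
Lemma hpoly1_of_family (H : hyperfieldType) (I : finType) (w : I -> nat)
    (c : I -> H) : injective w ->
  exists q : hpoly H 1, forall (H' : hyperfieldType) (G : nat -> H -> set H'),
    (forall k, G k h0 = [set h0]) ->
    \big[@hsetadd H'/[set h0]]_(d : expts q) G (tnth (val d) ord0) (coef d) =
    \big[@hsetadd H'/[set h0]]_i G (w i) (c i).
Proof.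
move=> w_inj; pose P i := `[< c i <> h0 >].
(* Coefficients of a polynomial must be nonzero, so only indices in [P] supply exponents. *)
pose E := [fset [tuple w i] | i in enum P]%fset.
have /choice [h hP] (d : E) : exists i, P i /\ [tuple w i] = val d.
  by have /imfsetP[/= i + ->] := valP d; rewrite mem_enum; exists i.
have ch0 d : c (h d) <> h0 by have [/asboolP] := hP d.
exists (@HPoly H 1 E _ ch0) => H' G G0 /=.
(* Indices outside [P] contribute [[set h0]], the neutral hypersummand. *)
rewrite [RHS](bigID P) /= [X in hsetadd _ X]big1 => [|i]; last first.
  by move=> /asboolPn /contrapT ->.
rewrite [hsetadd _ _]Monoid.mulm1.
rewrite (reindex_omap h (fun i => insub [tuple w i])) /= => [|i Pi].
  apply: eq_big => d; last by have [_ <-] := hP d.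
  by have [-> ->] := hP d; rewrite valK eqxx.
(* Injectivity of [w] makes [h] recover [i] from its exponent. Were two exponents equal, their
   coefficients would have to be hyperadded, giving a set instead of one coefficient. *)
have iE : [tuple w i] \in E by apply: in_imfset; rewrite /= mem_enum.
rewrite insubT /=; congr Some; apply: w_inj.
by have [_ /(congr1 (fun t => tnth t ord0))] := hP [` iE]%fset.
Qed.

(** Induction on the number of digits: the remainder modulo [M] is digit 0, and the quotient is the
    expansion of the other digits. *)
Lemma base_expansion_inj (M n : nat) (d e : 'I_n -> nat) :
  (forall i, d i < M) -> (forall i, e i < M) ->
  \sum_(i < n) d i * M ^ i = \sum_(i < n) e i * M ^ i -> d =1 e.
Proof.
elim: n d e => [|n IH] d e dM eM; first by move=> _ [].
have M0 : 0 < M by apply: leq_ltn_trans (dM ord0).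
have split g : \sum_(i < n.+1) g i * M ^ i =
    (\sum_(i < n) g (lift ord0 i) * M ^ i) * M + g ord0.
  rewrite big_ord_recl expn0 muln1 addnC big_distrl /=; congr (_ + _).
  by apply: eq_bigr => i _; rewrite /bump /= add1n expnSr mulnA.
rewrite !split => de.
have de0 : d ord0 = e ord0.
  by move/(congr1 (modn^~ M)): de; rewrite !modnMDl !modn_small.
move/(congr1 (divn^~ M)): de; rewrite !divnMDl // !divn_small // !addn0.
move=> /(IH (d \o lift ord0) (e \o lift ord0)) de i.
by case: (unliftP ord0 i) => [j ->|-> //]; apply: de => k /=.
Qed.

Theorem theorem4p1 (H1 H2 : hyperfieldType) (f : hyperfieldHom H1 H2)
    (hf : relatively_algebraically_closed f) (n : nat) (p : hpoly H1 n) :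
  zeros (pushforward f p) = [set map_tuple f a | a in zeros p].
Proof.
apply/seteqP; split=> [beta pbeta|_ [a pa <-]]; last first.
  by apply: hom_heval; exists h0 => //; exact: hom_0.
have [/choice [g gK] lift_root] := hf.
pose a := map_tuple g beta.
have fa : map_tuple f a = beta.
  by apply: eq_from_tnth => i; rewrite !tnth_map gK.
pose M := (\max_(d : expts p) \max_(i < n) tnth (val d) i).+1.
pose w (d : expts p) := \sum_(i < n) tnth (val d) i * M ^ i.
have ltM (d : expts p) i : tnth (val d) i < M.
  rewrite ltnS; apply: leq_trans (leq_bigmax d).
  exact: (leq_bigmax (F := fun i => tnth (val d) i) i).
have w_inj : injective w.
  move=> d e /base_expansion_inj de; apply/val_inj/eq_from_tnth.
  by apply: de => i; apply: ltM.
(* Entries of [a] may be zero, so some of these coefficients may vanish; [q] omits them. *)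
have [q qE] := hpoly1_of_family _ _ w
  (fun d : expts p => hmul (coef d) (monomial a (val d))) w_inj.
(* At 1 all powers of the variable are 1, and [f] sends [a] to [beta], so the hypersum is that of
   the push-forward of [p] at [beta]. *)
have q1 : zeros (pushforward f q) [tuple h1].
  have := qE H2 (fun k c => [set hmul (f c) (hexp h1 k)]).
  rewrite /zeros /= heval1 => -> => [|k]; last by rewrite hom_0 hmul_0l.
  apply: (eq_ind _ (@^~ h0) pbeta); apply: eq_bigr => d _ /=.
  by rewrite hexp1n [hmul _ h1]Monoid.mulm1 hom_mul hom_monomial fa.
have [alpha falpha qalpha] := lift_root q h1 q1.
exists [tuple hmul (tnth a i) (hexp alpha (M ^ i)) | i < n].
  move: qalpha; rewrite /zeros /= heval1.
  rewrite (qE H1 (fun k c => [set hmul c (hexp alpha k)])) => [|k]; last first.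
    by rewrite hmul_0l.
  move=> qalpha; apply: (eq_ind _ (@^~ h0) qalpha); apply: eq_bigr => d _.
  by rewrite monomial_subst hmulA.
(* The factors [alpha ^ (M ^ i)] map to 1, so the new tuple still lies over [beta]. *)
apply: eq_from_tnth => i; rewrite tnth_map tnth_mktuple hom_mul hom_hexp.
by rewrite falpha hexp1n [hmul _ h1]Monoid.mulm1 tnth_map gK.
Qed.
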